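(* Let $k\ge 3$ be an integer and let $(F^{(k)}_n)$ be the $k$-generalized Fibonacci sequence. The triples of integers $(n,d,m)$ with $n\ge 1$, $d\ge 0$, $m\ge 1$ satisfying \[\big(F^{(k)}_n\big)^2+\big(F^{(k)}_{n+d}\big)^2=F^{(k)}_m\] are exactly $(n,d,m)=(1,0,3)$, $(n,d,m)=(1,1,3)$, and $(n,d,m)=(a,0,2a-1)$ for integers $a$ with $2\le a\le \lfloor (k+2)/2\rfloor$.
   Context: For an integer $k\ge 2$, the $k$-generalized Fibonacci sequence $(F^{(k)}_n)_{n\ge -(k-2)}$ is defined by $F^{(k)}_{-k+2}=\cdots=F^{(k)}_0=0$, $F^{(k)}_1=1$, and $F^{(k)}_{n+k}=F^{(k)}_{n+k-1}+F^{(k)}_{n+k-2}+\cdots+F^{(k)}_n$ for $n\ge 0$.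
   Formalization: The recurrence is taken for all n ≥ -(k-2) (the standard definition) rather than only for n ≥ 0, since the stated range would leave F_2,…,F_{k-1} undefined for k ≥ 3. *)

(* Defs.v *)
From mathcomp Require Import all_boot all_order all_algebra.
From mathcomp Require Import zify.

Set Implicit Arguments.
Unset Strict Implicit.
Unset Printing Implicit Defensive.

Import Order.TTheory GRing.Theory Num.Theory.
Local Open Scope ring_scope.

Definition kfib_step (s : seq nat) : seq nat := rcons (behead s) (sumn s).

(* kfib_window k j lists the k consecutive terms
   F_(j+2-k), F_(j+3-k), ..., F_(j+1) (see nth_kfib_window). *)
Definition kfib_window (k j : nat) : seq nat :=
  iter j kfib_step (rcons (nseq k.-1 0%N) 1%N).

(* F^(k)_n, indexed by int.  The sequence only starts at index -(k-2); the
   definition also returns 0 below that.  The lemmas kfib_le0, kfib1 and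
   kfib_rec are its defining properties. *)
Definition kfib (k : nat) (n : int) : nat :=
  if n is Posz j.+1 then last 0%N (kfib_window k j) else 0%N.

Lemma kfib_le0 (k : nat) (n : int) : n <= 0 -> kfib k n = 0%N.
Proof. by case: n => [[|n]|n]. Qed.

Lemma kfib1 (k : nat) : kfib k 1 = 1%N.
Proof. by rewrite /kfib /kfib_window /= last_rcons. Qed.

Lemma size_kfib_window (k j : nat) : (0 < k)%N -> size (kfib_window k j) = k.
Proof.
move=> k0; elim: j => [|j IH].
  by rewrite /kfib_window /= size_rcons size_nseq prednK.
by rewrite /kfib_window iterS size_rcons size_behead -/(kfib_window k j) IH prednK.
Qed.

Lemma nth_kfib_window (k j i : nat) : (i < k)%N ->
  nth 0%N (kfib_window k j) i = kfib k ((j + i)%:Z + 2 - k%:Z).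
Proof.
move=> ltik; have k0 : (0 < k)%N by lia.
elim: j i ltik => [|j IH] i ltik.
  rewrite /kfib_window /= nth_rcons size_nseq nth_nseq.
  case: ltnP => hi; first by rewrite kfib_le0 //; lia.
  have -> : i = k.-1 by lia.
  by rewrite eqxx (_ : _ - _ = 1) ?kfib1 //; lia.
have [hi|hi] := ltnP i k.-1.
  rewrite /kfib_window iterS nth_rcons size_behead -/(kfib_window k j).
  by rewrite size_kfib_window // hi nth_behead IH; [congr kfib; lia | lia].
have -> : i = k.-1 by lia.
have -> : (j.+1 + k.-1)%:Z + 2 - k%:Z = Posz j.+2 by lia.
by rewrite /kfib -nth_last size_kfib_window.
Qed.

Lemma kfib_rec (k : nat) (n : int) : (0 < k)%N -> 2 - k%:Z <= n ->
  kfib k (n + k%:Z) = (\sum_(i < k) kfib k (n + i%:Z))%N.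
Proof.
move=> k0 hn; pose j := absz (n + k%:Z - 2)%R.
have En : n = j%:Z + 2 - k%:Z by rewrite /j; lia.
have -> : n + k%:Z = Posz j.+2 by lia.
rewrite /kfib /kfib_window iterS last_rcons -/(kfib_window k j).
rewrite sumnE (big_nth 0%N) size_kfib_window // big_mkord.
apply: eq_bigr => i _; rewrite nth_kfib_window // -/(kfib k _).
by congr kfib; lia.
Qed.

(* Main.v *)
Require Import Defs.
From mathcomp Require Import all_boot all_order all_algebra.
From mathcomp Require Import zify.

Import Order.TTheory GRing.Theory Num.Theory.
Local Open Scope ring_scope.

(** Since [F_(n+1)] counts the compositions of [n] into parts of size at most
    [k], cutting a composition of [a + b] at [a] yields
    [F_(a+b+1) = F_(a+1) F_(b+1) + \sum_(i + j < k - 1) F_(a-i) F_(b-j)],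
    where [i, j >= 0].
    Comparing this with the recurrence places the sum of squares strictly
    between two consecutive terms: for [1 <= n < N] and [N >= 3],
    [F_(2N-2) <= F_N^2 < F_n^2 + F_N^2 < F_(2N-1)], while for [n >= 2],
    [F_(2n-1) <= 2 F_n^2 < F_(2n)], the first inequality being an equality
    exactly when [2n - 1 <= k + 1], i.e. in the range where [F_j = 2^(j-2)]. *)

Definition kfibn (k n : nat) : nat := kfib k n%:Z.

(* Truncated subtraction in [n - i] is harmless because [kfibn k 0 = 0]. *)
Definition kfib_tail_sum (k r n : nat) : nat := (\sum_(i < r) kfibn k (n - i))%N.

Section KFibNat.
Local Open Scope nat_scope.

Variable p : nat.
Local Notation F := (kfibn p.+1).
Local Notation W := (kfib_tail_sum p.+1).

Lemma kfib_tail_sumS r n : W r.+1 n.+1 = F n.+1 + W r n.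
Proof. by rewrite /kfib_tail_sum big_ord_recl subn0. Qed.

Lemma leq_kfib_tail_sum_head r n : 0 < r -> F n.+1 <= W r n.+1.
Proof. by case: r => // r _; rewrite kfib_tail_sumS leq_addr. Qed.

Lemma kfib_tail_sum_split r n : W r.+1 n = W r n + F (n - r).
Proof. by rewrite /kfib_tail_sum big_ord_recr. Qed.

Lemma leq_kfib_tail_sum r s n : r <= s -> W r n <= W s n.
Proof.
move=> /subnK <-; elim: (s - r) => //= j IH.
by rewrite addSn kfib_tail_sum_split (leq_trans IH) ?leq_addr.
Qed.

Lemma kfib_nat_rec n : F n.+2 = W p.+1 n.+1.
Proof.
rewrite /kfibn /kfib_tail_sum; have -> : n.+2%:Z = ((n.+2%:Z - p.+1%:Z) + p.+1%:Z)%R by lia.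
rewrite kfib_rec //; last by lia.
rewrite (reindex_inj rev_ord_inj) /=; apply: eq_bigr => i _.
have := ltn_ord i => ltip.
have [lein|ltni] := leqP i n.+1; first by rewrite /kfibn; congr kfib; lia.
by rewrite /kfibn !kfib_le0 //; lia.
Qed.

Lemma kfib_natS n : F n.+2 = F n.+1 + W p n.
Proof. by rewrite kfib_nat_rec kfib_tail_sumS. Qed.

(** Consecutive instances of the recurrence share all but their end terms. Where the shared window
    runs past index 0, the truncated [F (n.+1 - p)] is 0. *)
Lemma kfib_nat_double n : F n.+3 + F (n.+1 - p) = 2 * F n.+2.
Proof.
by rewrite kfib_natS -addnA -kfib_tail_sum_split -kfib_nat_rec mul2n addnn.
Qed.

Lemma kfib_gt0 n : 0 < F n.+1.
Proof.
elim: n => [|n IH]; first by rewrite /kfibn kfib1.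
by rewrite kfib_natS (leq_trans IH) ?leq_addr.
Qed.

Lemma leq_kfib m n : m <= n -> F m <= F n.
Proof.
move=> /subnK <-; elim: (n - m) => //= j IH; apply: leq_trans IH _.
rewrite addSn; case: (j + m) => [|i]; first by rewrite /kfibn kfib_le0.
by rewrite kfib_natS leq_addr.
Qed.

Lemma ltn_kfib m n : 0 < p -> 2 < n -> m < n -> F m < F n.
Proof.
case: n => [|[|[|n]]] // p0 _ ltmn; apply: leq_ltn_trans (leq_kfib _ _ (ltmn : m <= n.+2)) _.
rewrite [F n.+3]kfib_natS -[ltnLHS]addn0 ltn_add2l.
exact: leq_trans (kfib_gt0 n) (leq_kfib_tail_sum_head _ _ p0).
Qed.

Lemma kfib_pow2 n : n <= p -> F n.+2 = 2 ^ n.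
Proof.
elim: n => [|n IH] lenp.
  by rewrite kfib_natS /kfib_tail_sum big1 => [|i _]; rewrite /kfibn ?kfib1 // sub0n.
have := kfib_nat_double n; rewrite (eqP lenp : n.+1 - p = 0).
by rewrite IH 1?ltnW // expnS /kfibn [kfib _ 0%N]kfib_le0 // addn0.
Qed.

(** [W (p - i) b] sums over the [j] with [i + j < p]: a part straddling the cut extends [i + 1] to
    its left and [j + 1] to its right. The induction on [b] shifts the cut by one. *)
Lemma kfib_add a b :
  F (a.+1 + b) = F a.+1 * F b.+1 + \sum_(i < p) F (a - i) * W (p - i) b.
Proof.
elim: b a => [|b IH] a.
  rewrite addn0 /kfibn kfib1 muln1 big1 ?addn0 // => i _.
  by rewrite /kfib_tail_sum big1 ?muln0 // => j _; rewrite sub0n.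
rewrite addnS -addSn IH kfib_nat_rec kfib_tail_sumS mulnDl.
(* Both sides split one sum over [i <= p], at its last and at its first term; for
   [G i = W (p - i) b] the last term vanishes. *)
have shift (G : nat -> nat) : \sum_(i < p) F (a.+1 - i) * G i + F (a.+1 - p) * G p
    = F a.+1 * G 0 + \sum_(i < p) F (a - i) * G i.+1.
  transitivity (\sum_(i < p.+1) F (a.+1 - i) * G i); first by rewrite big_ord_recr.
  by rewrite big_ord_recl subn0.
have W0 : W 0 b = 0 by rewrite /kfib_tail_sum big_ord0.
have := shift (fun i => W (p - i) b).
rewrite subnn subn0 W0 muln0 addn0 => ->.
rewrite addnACA -mulnDr -kfib_natS; congr addn.
rewrite big_distrl -big_split /=; apply: eq_bigr => i _.
rewrite -mulnDr; congr muln.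
by rewrite -(subnSK (ltn_ord i)) kfib_tail_sumS.
Qed.

(** Expanding one factor [F N.+2] by the recurrence allows a termwise comparison with [kfib_add],
    whose windows are all contained in that of [F N.+2]. *)
Lemma kfib_double_even_le N : F (N.+1 + N.+1) <= F N.+2 ^ 2.
Proof.
rewrite kfib_add -mulnn {2}kfib_nat_rec kfib_tail_sumS mulnDl leq_add2l.
rewrite /kfib_tail_sum big_distrl /=; apply: leq_sum => i _.
by rewrite leq_mul2l kfib_nat_rec leq_kfib_tail_sum ?orbT // leqW ?leq_subr.
Qed.

(** The term [i = 0] of [kfib_add] suffices: for [p > 1] its window contains [F N.+1 > 0] besides
    [F N.+2]. *)
Lemma sqr_kfib_lt N : 1 < p ->
  F N.+3 ^ 2 + F N.+2 ^ 2 < F (N.+3 + N.+2).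
Proof.
move=> p1.
have WE : W p N.+2 = F N.+2 + (F N.+1 + W p.-2 N).
  by rewrite -!kfib_tail_sumS; congr kfib_tail_sum; lia.
have p0 : 0 < p by lia.
rewrite -mulnn kfib_add -addnS leq_add2l (bigD1 (Ordinal p0)) //= !subn0 -mulnn.
apply: leq_trans (leq_addr _ _).
have := kfib_gt0 N.+1; have := kfib_gt0 N; rewrite WE; nia.
Qed.

Lemma double_sqr_kfib_lt n : 1 < p -> 2 * F n.+2 ^ 2 < F (n.+2 + n.+2).
Proof.
move=> p1.
(* Every window on the right contains [F n.+2]; the one for [i = 0] also contains [F n.+1], whence
   the extra square. *)
have lb : F n.+2 * W p n.+1 + F n.+1 ^ 2
    <= \sum_(i < p) F (n.+1 - i) * W (p - i) n.+2.
  have p0 : 0 < p by lia.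
  rewrite /kfib_tail_sum big_distrr (bigD1 (Ordinal p0)) //= addnAC.
  rewrite [leqRHS](bigD1 (Ordinal p0)) //= !subn0 -/(W _ _).
  apply: leq_add.
    have -> : W p n.+2 = F n.+2 + (F n.+1 + W p.-2 n).
      by rewrite -!kfib_tail_sumS; congr kfib_tail_sum; lia.
    by rewrite -mulnn mulnC -mulnDr leq_mul2l !leq_add2l leq_addr orbT.
  apply: leq_sum => i _; rewrite mulnC leq_mul2l -/(W _ _).
  by rewrite leq_kfib_tail_sum_head ?orbT // subn_gt0.
rewrite kfib_add [F n.+3]kfib_natS; apply: leq_trans (leq_add (leqnn _) lb).
(* With [x = F n.+1], [y = W p n.+1] and [z = F (n.+1 - p)], the claim reduces to [z^2 < x^2 + y^2],
   where [z <= y] and [x > 0]. *)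
have e : F n.+2 = W p n.+1 + F (n.+1 - p) by rewrite kfib_nat_rec kfib_tail_sum_split.
have le1 : F (n.+1 - p) <= W p n.+1.
  apply: (@leq_trans (F n.+1)); first by rewrite leq_kfib ?leq_subr.
  exact: leq_kfib_tail_sum_head (ltnW p1).
have := kfib_gt0 n; rewrite -!mulnn e; move: le1; clear.
by move: (F n.+1) (W _ _) (F _) => x y z; nia.
Qed.

(** One square cancels against the product in [kfib_add]; the other, expanded by the recurrence,
    dominates the sum termwise with one term to spare. *)
Lemma kfib_le_double_sqr n : F (n.+2 + n.+1) <= 2 * F n.+2 ^ 2.
Proof.
rewrite kfib_add mul2n -addnn mulnn leq_add2l -mulnn {1}kfib_nat_rec.
rewrite /kfib_tail_sum big_distrl big_ord_recr /=; apply: leq_trans (leq_addr _ _).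
apply: leq_sum => i _.
by rewrite leq_mul2l kfib_nat_rec leq_kfib_tail_sum ?orbT // leqW ?leq_subr.
Qed.

(* For [p <= n] the last term of the recurrence for [F n.+2] is positive and is
   not matched at all in [kfib_add]; otherwise the term [F 1 = 1] is matched
   with a window sum smaller than [F n.+2]. *)
Lemma kfib_lt_double_sqr n : p < n.*2.+1 -> F (n.+2 + n.+1) < 2 * F n.+2 ^ 2.
Proof.
move=> ltp.
rewrite kfib_add mul2n -addnn mulnn ltn_add2l -mulnn {1}kfib_nat_rec.
have leT i : F (n.+1 - i) * W (p - i) n.+1 <= F (n.+1 - i) * F n.+2.
  by rewrite leq_mul2l kfib_nat_rec leq_kfib_tail_sum ?orbT // leqW ?leq_subr.
rewrite /kfib_tail_sum big_distrl big_ord_recr /=.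
have [lepn|ltnp] := leqP p n.
  apply: leq_trans (_ : (\sum_(i < p) F (n.+1 - i) * F n.+2).+1 <= _).
    by rewrite ltnS; apply: leq_sum.
  by rewrite -[ltnLHS]addn0 ltn_add2l muln_gt0 kfib_gt0 subSn // kfib_gt0.
apply: leq_trans (leq_addr _ _).
rewrite (bigD1 (Ordinal ltnp)) //= [ltnRHS](bigD1 (Ordinal ltnp)) //= -addSn.
apply: leq_add; last by apply: leq_sum.
rewrite subSnn ltn_mul2l kfib_gt0 /= kfib_nat_rec.
apply: leq_trans (leq_kfib_tail_sum (p - n).+1 p.+1 _ _); last by lia.
rewrite kfib_tail_sum_split -[ltnLHS]addn0 ltn_add2l.
(* The larger window gains a term whose index is positive because [p <= 2n]. *)
by have -> : n.+1 - (p - n) = (n.*2 - p).+1; [lia | exact: kfib_gt0].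
Qed.

End KFibNat.

Theorem theorem3p4 (k : nat) (hk : (3 <= k)%N) (n d m : int) :
  (1 <= n /\ 0 <= d /\ 1 <= m /\
   (kfib k n ^ 2 + kfib k (n + d)%R ^ 2)%N = kfib k m)
  <->
  ((n, d, m) = (1, 0, 3) \/
   (n, d, m) = (1, 1, 3) \/
   exists a : int, 2 <= a /\ a <= ((k%:Z + 2) %/ 2)%Z /\
     (n, d, m) = (a, 0, 2 * a - 1)).
Proof.
case: k hk => // p p1; have {p1} p1 : (1 < p)%N by lia.
have F1 : kfibn p.+1 1 = 1%N by rewrite /kfibn kfib1.
have F2 : kfibn p.+1 2 = 1%N by rewrite kfib_pow2.
have F3 : kfibn p.+1 3 = 2%N by rewrite kfib_pow2 ?expn1 //; lia.
have FltK i j : (kfibn p.+1 i < kfibn p.+1 j)%N -> (i < j)%N.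
  by rewrite !ltnNge; apply: contra; apply: leq_kfib.
have F2K i : kfibn p.+1 i = 2%N -> i = 3%N.
  move=> Fi; have : (2 < i)%N by apply: FltK; rewrite Fi F2.
  have : (i < 4)%N by apply: FltK; rewrite Fi kfib_pow2.
  lia.
split; last first.
  case=> [[-> -> ->]|[[-> -> ->]|[a [a2 [ak [-> -> ->]]]]]].
  - by rewrite -!/(kfibn _ 1) -/(kfibn _ 3) F1 F3.
  - by rewrite -!/(kfibn _ 1) -/(kfibn _ 2) -/(kfibn _ 3) F1 F2 F3.
  - split; [lia | split; [lia | split; [lia |]]].
    (* Both sides become [2 ^ (2b + 1)]; the exponent is at most [p] exactly when [2a <= k + 2]. *)
    pose b := (absz a).-2.
    have -> : a + 0 = (b.+2)%:Z by lia.
    have -> : a = (b.+2)%:Z by lia.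
    have -> : 2 * b.+2%:Z - 1 = (b.*2.+3)%:Z by lia.
    rewrite -!/(kfibn _ _) !kfib_pow2; try lia.
    by rewrite addnn -mul2n -expnM -expnS muln2.
case: n d m => [[|n]|n] [d|d] [[|m]|m] [n1 [d0 [m1]]]; try lia.
clear n1 d0 m1.
rewrite -PoszD -!/(kfibn _ _).
case: d => [|d]; rewrite ?addn0 ?addnn -?mul2n => eqF.
  case: n eqF => [|n] eqF.
    by left; congr (_, _, Posz _); apply: F2K; rewrite -eqF F1.
  right; right; exists n.+2%:Z.
  (* The two bounds pin [m.+1] to [2n + 3]; equality in the lower one then forces [2n + 1 <= p], the
     upper bound on [a = n + 2]. *)
  have lt1 := double_sqr_kfib_lt p n p1.
  have le1 := kfib_le_double_sqr p n.
  rewrite eqF in lt1 le1.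
  have /FltK ltm := lt1.
  have lem : (n.+2 + n.+1 <= m.+1)%N.
    have n3 : (2 < n.+2 + n.+1)%N by lia.
    rewrite leqNgt; apply/negP => /(ltn_kfib p _ _ (ltnW p1) n3).
    by rewrite ltnNge le1.
  have em : m.+1 = (n.+2 + n.+1)%N by lia.
  have : ~~ (p < n.*2.+1)%N.
    by apply/negP => /kfib_lt_double_sqr; rewrite eqF em ltnn.
  by split=> //; split; [lia | congr (_, _, _); lia].
have [/andP[/eqP n0 /eqP d0]|nd] := boolP ((n == 0%N) && (d == 0%N)).
  rewrite n0 d0 F1 F2 in eqF *; right; left; congr (_, _, Posz _).
  by apply: F2K; rewrite -eqF.
(* The larger index is [N + 3] and the smaller at most [N + 2], so [m.+1] would lie strictly between
   [2N + 4] and [2N + 5]. *)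
exfalso; pose N := (n + d).-1.
have EN : (n.+1 + d.+1 = N.+3)%N by lia.
rewrite EN in eqF.
have ub : (kfibn p.+1 m.+1 < kfibn p.+1 (N.+3 + N.+2))%N.
  apply: leq_ltn_trans (sqr_kfib_lt p N p1).
  by rewrite -eqF addnC leq_add2l leq_sqr leq_kfib //; lia.
have lb : (kfibn p.+1 (N.+2 + N.+2) < kfibn p.+1 m.+1)%N.
  apply: leq_ltn_trans (kfib_double_even_le p N.+1) _.
  by rewrite -eqF -add1n leq_add2r expn_gt0 kfib_gt0.
by move/FltK: ub; move/FltK: lb; lia.
Qed.
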